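(* For each $S\in\{\mathbf{s}(0),\mathbf{s}(1),\mathbf{s}(2),\bar{\mathbf{s}}(0),\bar{\mathbf{s}}(1),\bar{\mathbf{s}}(2)\}$, the family $\mathcal{T}_S$ equals the family $\mathcal{F}_S$ of all minimally $S$-forcing 2-terminal series-parallel graphs $(G,s,t)$ with respect to $C_5$.
   Context: A $C_5$-colouring of $G$ is a map $\phi:V(G)\to\mathbb{Z}_5$ with $\phi(u)-\phi(v)=\pm1$ for every edge $uv$. A 2-terminal graph $(G,s,t)$ is a graph with two distinct distinguished vertices. The serial sum $(G_1,s_1,t_1)+(G_2,s_2,t_2)$ identifies $t_1$ with $s_2$, with terminals $s_1,t_2$; the parallel sum $G_1\,\|\,G_2$ identifies $s_1$ with $s_2$ and $t_1$ with $t_2$. A 2-terminal series-parallel graph is one built from single edges ($K_2$ with its ends as terminals) by serial and parallel sums. For nonempty $S\subseteq\mathbb{Z}_5$, $(G,s,t)$ is $S$-forcing if $S=\{x:\exists$ a $C_5$-colouring $\phi$ of $G$ with $\phi(s)=0,\phi(t)=x\}$, and minimally $S$-forcing if it is $S$-forcing and no proper subgraph $(G',s,t)$ is $S$-forcing. For $i\in\mathbb{Z}_5$, $\mathbf{s}(i)=\{i,-i\}$ and $\bar{\mathbf{s}}(i)=\mathbb{Z}_5\setminus\{i,-i\}$. The families $\mathcal{T}_{\mathbf{s}(0)},\mathcal{T}_{\bar{\mathbf{s}}(0)},\mathcal{T}_{\mathbf{s}(1)},\mathcal{T}_{\bar{\mathbf{s}}(1)},\mathcal{T}_{\mathbf{s}(2)},\mathcal{T}_{\bar{\mathbf{s}}(2)}$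 of 2-terminal graphs are the minimal families such that $K_2\in\mathcal{T}_{\mathbf{s}(1)}$ and: (i) for distinct $i,j\in\{0,1,2\}$, if $G\in\mathcal{T}_{\bar{\mathbf{s}}(i)}$ and $H\in\mathcal{T}_{\bar{\mathbf{s}}(j)}$ then $G\,\|\,H\in\mathcal{T}_{\mathbf{s}(\ell)}$ where $\{\ell\}=\{0,1,2\}\setminus\{i,j\}$; (ii) if $G,H\in\mathcal{T}_{\mathbf{s}(i)}$ for some $i\in\{1,2\}$ then $G+H\in\mathcal{T}_{\bar{\mathbf{s}}(i)}$; (iii) if $G\in\mathcal{T}_{\mathbf{s}(i)}$ and $H\in\mathcal{T}_{\bar{\mathbf{s}}(i)}$ for some $i\in\{1,2\}$ then $G+H\in\mathcal{T}_{\bar{\mathbf{s}}(0)}$; (iv) if $G\in\mathcal{T}_S$ for one of the six sets $S$ and $H\in\mathcal{T}_{\mathbf{s}(0)}$, then $G+H\in\mathcal{T}_S$.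
   Formalization: The families T_S are additionally closed under isomorphism and under exchanging the terminals s and t; with ordered terminals the claim fails, since for H in T_{s(0)} the graph H+K_2 is minimally s(1)-forcing but not generated by rules (i)–(iv). *)

(* Defs.v *)
From HB Require Import structures.
From mathcomp Require Import all_boot all_algebra.
Set Implicit Arguments.
Unset Strict Implicit.
Unset Printing Implicit Defensive.
Import GRing.Theory.
Local Open Scope ring_scope.

(** Finite loopless graphs, with parallel edges allowed (a parallel sum may
    create them), and two distinct terminals.  Edges are unoriented: [ends e]
    is the two-element set of end vertices of [e]. *)
Record tgraph := TGraph {
  vert : finType;
  edge : finType;
  ends : edge -> {set vert};
  src : vert;
  tgt : vert;
  card_ends : forall e, #|ends e| = 2%N;
  src_neq_tgt : src != tgt
}.
Arguments src {t}.
Arguments tgt {t}.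

Definition is_embedding (H G : tgraph)
    (fv : vert H -> vert G) (fe : edge H -> edge G) : Prop :=
  [/\ injective fv, injective fe, forall e, ends (fe e) = fv @: ends e,
      fv src = src & fv tgt = tgt].

Definition iso (H G : tgraph) : Prop :=
  exists fv fe, [/\ @is_embedding H G fv fe, bijective fv & bijective fe].

Definition proper_subgraph (H G : tgraph) : Prop :=
  exists fv fe, @is_embedding H G fv fe /\ ~ (bijective fv /\ bijective fe).

Lemma tgt_neq_src (G : tgraph) : @tgt G != src.
Proof. by rewrite eq_sym src_neq_tgt. Qed.

Definition reverse (G : tgraph) : tgraph :=
  @TGraph (vert G) (edge G) (@ends G) tgt src (@card_ends G) (tgt_neq_src G).

(** Two-terminal graphs are taken up to isomorphism, and the two distinguished
    vertices form an unordered pair: (G,s,t) and (G,t,s) are not distinguished.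
    Without this, the sums [G + H] with [H] in the s(0) family could only be
    formed on one side, and the generated families would miss, e.g., [H + K2],
    which is minimally s(1)-forcing. *)
Definition same_tgraph (G H : tgraph) : Prop := iso G H \/ iso G (reverse H).

Lemma card_K2_ends (e : unit) : #|[set: bool]| = 2%N.
Proof. by rewrite cardsT card_bool. Qed.

Definition K2 : tgraph :=
  @TGraph bool unit (fun=> [set: bool]) false true card_K2_ends isT.

Section Sums.
Variables G H : tgraph.

(** Serial sum: [src] of [H] is removed from the disjoint union and replaced by
    [tgt] of [G]. *)
Definition serial_vert : finType := (vert G + {x : vert H | x != src})%type.

Definition serial_inr (x : vert H) : serial_vert :=
  if insub x is Some y then inr y else inl tgt.

Definition serial_ends (e : edge G + edge H) : {set serial_vert} :=
  match e with
  | inl e1 => inl @: ends e1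
  | inr e2 => serial_inr @: ends e2
  end.

Lemma serial_inr_inj : injective serial_inr.
Proof.
move=> x y; rewrite /serial_inr.
case: insubP => [u _ <-|/negPn/eqP ->]; case: insubP => [v _ <-|/negPn/eqP ->] //.
by case=> ->.
Qed.

Lemma card_serial_ends e : #|serial_ends e| = 2%N.
Proof.
case: e => e /=; rewrite card_imset ?card_ends //; first by move=> x y [].
exact: serial_inr_inj.
Qed.

Lemma serial_src_neq_tgt : inl src != serial_inr tgt.
Proof.
rewrite /serial_inr; case: insubP => [//|].
by rewrite eq_sym src_neq_tgt.
Qed.

Definition serial : tgraph :=
  @TGraph serial_vert (edge G + edge H)%type serial_ends
    (inl src) (serial_inr tgt) card_serial_ends serial_src_neq_tgt.

(** Parallel sum: both terminals of [H] are removed from the disjoint union and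
    replaced by the corresponding terminals of [G]. *)
Definition parallel_vert : finType :=
  (vert G + {x : vert H | x \notin [set src; tgt]})%type.

Definition parallel_inr (x : vert H) : parallel_vert :=
  if insub x is Some y then inr y else inl (if x == src then src else tgt).

Definition parallel_ends (e : edge G + edge H) : {set parallel_vert} :=
  match e with
  | inl e1 => inl @: ends e1
  | inr e2 => parallel_inr @: ends e2
  end.

Lemma parallel_inr_inj : injective parallel_inr.
Proof.
have nG := src_neq_tgt G; have nH := src_neq_tgt H.
move=> x y; rewrite /parallel_inr.
case: insubP => [u _ <-|]; case: insubP => [v _ <-|] //; first by case=> ->.
rewrite !negbK !inE => /orP[]/eqP-> /orP[]/eqP->; rewrite ?eqxx //.
  by rewrite eq_sym (negbTE nH) => -[/eqP]; rewrite eq_sym (negbTE nG).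
by rewrite eq_sym (negbTE nH) => -[/eqP]; rewrite (negbTE nG).
Qed.

Lemma card_parallel_ends e : #|parallel_ends e| = 2%N.
Proof.
case: e => e /=; rewrite card_imset ?card_ends //; first by move=> x y [].
exact: parallel_inr_inj.
Qed.

Lemma parallel_src_neq_tgt : inl src != inl tgt :> parallel_vert.
Proof. by apply: contra (src_neq_tgt G) => /eqP[->]. Qed.

Definition parallel : tgraph :=
  @TGraph parallel_vert (edge G + edge H)%type parallel_ends
    (inl src) (inl tgt) card_parallel_ends parallel_src_neq_tgt.

End Sums.

Inductive series_parallel : tgraph -> Prop :=
| sp_K2 : series_parallel K2
| sp_serial G H :
    series_parallel G -> series_parallel H -> series_parallel (serial G H)
| sp_parallel G H :
    series_parallel G -> series_parallel H -> series_parallel (parallel G H)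
| sp_same G H : same_tgraph G H -> series_parallel G -> series_parallel H.

Definition C5_colouring (G : tgraph) (phi : vert G -> 'Z_5) : Prop :=
  forall e u v, ends e = [set u; v] -> phi u - phi v = 1 \/ phi u - phi v = -1.

Definition forcing (S : {set 'Z_5}) (G : tgraph) : Prop :=
  S != set0 /\
  forall x, x \in S <->
    exists phi : vert G -> 'Z_5,
      [/\ C5_colouring phi, phi src = 0 & phi tgt = x].

Definition minimally_forcing (S : {set 'Z_5}) (G : tgraph) : Prop :=
  forcing S G /\ forall H, proper_subgraph H G -> ~ forcing S H.

Definition sset (i : 'Z_5) : {set 'Z_5} := [set i; - i].
Definition sbar (i : 'Z_5) : {set 'Z_5} := ~: [set i; - i].

Definition six_sets : seq {set 'Z_5} :=
  [:: sset 0; sset 1; sset 2; sbar 0; sbar 1; sbar 2].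

Inductive calT : {set 'Z_5} -> tgraph -> Prop :=
| calT_K2 : calT (sset 1) K2
| calT_parallel (i j l : 'Z_5) G H :
    i \in [set 0; 1; 2] -> j \in [set 0; 1; 2] -> i != j ->
    [set l] = [set 0; 1; 2] :\: [set i; j] ->
    calT (sbar i) G -> calT (sbar j) H -> calT (sset l) (parallel G H)
| calT_serial_bar (i : 'Z_5) G H :
    i \in [set 1; 2] ->
    calT (sset i) G -> calT (sset i) H -> calT (sbar i) (serial G H)
| calT_serial_bar0 (i : 'Z_5) G H :
    i \in [set 1; 2] ->
    calT (sset i) G -> calT (sbar i) H -> calT (sbar 0) (serial G H)
| calT_serial0 S G H :
    S \in six_sets ->
    calT S G -> calT (sset 0) H -> calT S (serial G H)
| calT_same S G H : same_tgraph G H -> calT S G -> calT S H.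

Definition calF (S : {set 'Z_5}) (G : tgraph) : Prop :=
  series_parallel G /\ minimally_forcing S G.

(* Main.v *)
(** Let C(G) be the set of differences phi(t) - phi(s) over all C5-colourings.
    It is symmetric, C(G + H) is the sumset of C(G) and C(H), and C(G || H) is
    their intersection.  A series-parallel graph has no isolated vertex and C
    is antitone in the edge set, so minimality of G means that deleting any
    single edge strictly enlarges C(G); this property passes to the summands.
    The sumset of two symmetric proper sets is proper only if one of them is
    s(0), or they are s(i), s(i), or s(i), sbar(i), or s(1), s(2).  The last
    case gives sbar(0) but is never minimal: every minimal s(2)-forcing graph
    has an edge whose deletion yields {0, 2, -2}, and s(1) + {0, 2, -2} is still
    sbar(0).  In a minimal parallel sum the two sets are incomparable, hence
    of the form sbar(i), sbar(j). *)
Require Import Defs.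
From mathcomp Require Import all_boot all_algebra.
Set Implicit Arguments.
Unset Strict Implicit.
Unset Printing Implicit Defensive.
Import GRing.Theory.
Local Open Scope ring_scope.

(** * Colourings of edge subsets and their difference sets *)

(** Phrased for a set of vertices, so that no order of the two ends is chosen and the condition
    transports along injective vertex maps. *)
Definition proper_on (V : finType) (phi : V -> 'Z_5) (X : {set V}) : bool :=
  [forall u in X, forall v in X, (u != v) ==> (phi u - phi v \in sset 1)].

Lemma proper_onP (V : finType) (phi : V -> 'Z_5) (X : {set V}) :
  reflect {in X &, forall u v, u != v -> phi u - phi v \in sset 1}
          (proper_on phi X).
Proof.
apply: (iffP forall_inP) => [h u v uX vX | h u uX].
  by have /forall_inP/(_ v vX)/implyP := h u uX.
by apply/forall_inP => v vX; apply/implyP; apply: h.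
Qed.

Lemma proper_on_imset (V W : finType) (f : V -> W) (phi : W -> 'Z_5) (X : {set V}) :
  injective f -> proper_on phi (f @: X) = proper_on (phi \o f) X.
Proof.
move=> f_inj; apply/proper_onP/proper_onP => h.
  by move=> u v uX vX uv; apply: h; rewrite ?imset_f ?inj_eq.
by move=> _ _ /imsetP[u uX ->] /imsetP[v vX ->]; rewrite inj_eq //; apply: h.
Qed.

Lemma sset1N x : (- x \in sset 1) = (x \in sset 1).
Proof. by rewrite !inE eqr_oppLR eqr_opp orbC. Qed.

(** Edge deletion is modelled by shrinking [D], with the graph itself kept fixed. *)
Definition coloured (G : tgraph) (D : {set edge G}) (phi : vert G -> 'Z_5) :=
  [forall e in D, proper_on phi (ends e)].

Section Coloured.
Variable G : tgraph.
Implicit Types (D : {set edge G}) (phi psi : vert G -> 'Z_5).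

Lemma eq_coloured D phi psi : phi =1 psi -> coloured D phi = coloured D psi.
Proof.
move=> eq_phi; rewrite /coloured; apply: eq_forallb => e; congr (_ ==> _).
by apply/proper_onP/proper_onP => h u v *; [rewrite -!eq_phi | rewrite !eq_phi]; apply: h.
Qed.

Lemma coloured_shift D phi c :
  coloured D (fun x => phi x + c) = coloured D phi.
Proof.
rewrite /coloured; apply: eq_forallb => e; congr (_ ==> _).
by apply/proper_onP/proper_onP => h u v uX vX uv; move: (h u v uX vX uv);
   rewrite opprD addrACA subrr addr0.
Qed.

Lemma coloured_opp D phi : coloured D phi -> coloured D (fun x => - phi x).
Proof.
move=> /forall_inP h; apply/forall_inP => e /h /proper_onP {}h.
by apply/proper_onP => u v uX vX uv; rewrite -opprD sset1N; apply: h.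
Qed.

Lemma coloured_sub D D' phi : D \subset D' -> coloured D' phi -> coloured D phi.
Proof. by move=> /subsetP sD /forall_inP h; apply/forall_inP => e /sD/h. Qed.

Lemma colouredT phi : reflect (C5_colouring phi) (coloured setT phi).
Proof.
apply: (iffP forall_inP) => [h e u v eE | h e _].
  have /proper_onP/(_ u v) := h e (in_setT e).
  (* As [ends e] has two elements, [u] and [v] are distinct. *)
  have := card_ends e; rewrite eE cards2 !inE !eqxx orbT; case: eqP => //= _ _.
  by move=> /(_ isT isT isT) /orP[]/eqP->; [left | right].
apply/proper_onP => u v uX vX uv.
have eE : ends e = [set u; v].
  by apply/esym/eqP; rewrite eqEcard subUset !sub1set uX vX card_ends cards2 uv.
by case: (h _ _ _ eE) => ->; rewrite !inE eqxx ?orbT.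
Qed.

(** Differences are used instead of the normalisation [phi src = 0]; colourings are finite functions
    so that existence is a boolean. *)
Definition cset D : {set 'Z_5} :=
  [set x | [exists phi : {ffun vert G -> 'Z_5},
              coloured D phi && (phi tgt - phi src == x)]].

Lemma csetP D x :
  reflect (exists2 phi, coloured D phi & phi tgt - phi src = x) (x \in cset D).
Proof.
rewrite inE; apply: (iffP existsP) => [[phi /andP[c /eqP<-]] | [phi c <-]].
  by exists phi.
exists (finfun phi); rewrite !ffunE eqxx andbT.
by rewrite (@eq_coloured _ _ phi) // => y; rewrite ffunE.
Qed.

Lemma csetS D D' : D \subset D' -> cset D' \subset cset D.
Proof.
by move=> sD; apply/subsetP => x /csetP[phi c <-]; apply/csetP; exists phi;
   rewrite ?(coloured_sub sD).
Qed.

Lemma csetN D x : (- x \in cset D) = (x \in cset D).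
Proof.
suff h y : y \in cset D -> - y \in cset D.
  by apply/idP/idP => /h; rewrite ?opprK.
case/csetP=> phi /coloured_opp c <-; apply/csetP; eexists; first exact: c.
by rewrite -opprD.
Qed.

Lemma forcingE S : forcing S G <-> S != set0 /\ cset setT = S.
Proof.
have E x : x \in cset setT <->
    exists phi, [/\ @C5_colouring G phi, phi src = 0 & phi tgt = x].
  split=> [/csetP[phi c <-] | [phi [/colouredT c s t]]].
    (* Translation moves the colour of the source to 0. *)
    exists (fun y => phi y + - phi src); split; rewrite ?subrr //.
    by apply/colouredT; rewrite coloured_shift.
  by apply/csetP; exists phi; rewrite // s t subr0.
split=> -[Sn0 h]; split=> //; last by move=> x; rewrite -h.
by apply/setP => x; apply/idP/idP => [/E/h | /h/E].
Qed.

End Coloured.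

(** * Invariance of difference sets under embeddings and reversal *)

(** Colourings of [D] restrict along [fv], and those of its preimage extend. This serves
    isomorphisms and proper subgraphs alike. *)
Lemma cset_embedding (H G : tgraph) fv fe (D : {set edge G}) :
  @is_embedding H G fv fe -> D \subset fe @: setT ->
  cset D = cset (fe @^-1: D).
Proof.
case=> fv_inj fe_inj efe fsrc ftgt sD.
have cE phi : coloured D phi = coloured (fe @^-1: D) (phi \o fv).
  apply/forall_inP/forall_inP => h e.
    by rewrite inE => /h; rewrite efe proper_on_imset.
  move=> eD; have /imsetP[e' _ eE] := subsetP sD e eD.
  by rewrite eE efe proper_on_imset //; apply: h; rewrite inE -eE.
apply/setP => x; apply/csetP/csetP => -[phi c <-].
  by exists (phi \o fv); rewrite -?cE //= fsrc ftgt.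
(* Vertices outside the image of [fv] get the default colour 0, which is harmless: each edge of [D]
   is the image of an edge of [H] and so avoids them. *)
pose psi y := if [pick x | fv x == y] is Some x then phi x else 0.
have psiE y : psi (fv y) = phi y.
  rewrite /psi; case: pickP => [z /eqP/fv_inj-> // | /(_ y)].
  by rewrite eqxx.
exists psi; last by rewrite -fsrc -ftgt !psiE.
by rewrite cE (@eq_coloured _ _ _ phi).
Qed.

Lemma cset_iso (H G : tgraph) fv fe (D : {set edge G}) :
  @is_embedding H G fv fe -> bijective fe -> cset D = cset (fe @^-1: D).
Proof.
move=> emb [ef feK efK]; apply: (cset_embedding emb).
by apply/subsetP => e _; apply/imsetP; exists (ef e); rewrite ?efK.
Qed.

(** Exchanging the terminals negates each difference, and difference sets are closed under
    negation. *)
Lemma cset_reverse (G : tgraph) (D : {set edge G}) :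
  @cset (reverse G) D = @cset G D.
Proof.
suff h D' x : x \in @cset G D' -> - x \in @cset (reverse G) D'.
  apply/setP => x; apply/idP/idP; last by move/h; rewrite csetN.
  case/csetP=> phi c <-; rewrite -csetN opprB.
  by apply/csetP; exists phi.
by case/csetP=> phi c <-; rewrite opprB; apply/csetP; exists phi.
Qed.

(** * Difference sets of serial and parallel sums *)

Section SerialColourings.
Variables G H : tgraph.
Implicit Type D : {set edge (serial G H)}.

Lemma serial_inr_src : serial_inr G (@src H) = inl tgt.
Proof. by rewrite /serial_inr insubF ?eqxx. Qed.

Lemma serial_inr_val y : serial_inr G (val y) = inr y :> serial_vert G H.
Proof. by rewrite /serial_inr valK. Qed.

Lemma coloured_serial D phi :
  coloured D phi = coloured (inl @^-1: D) (phi \o inl)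
                   && coloured (inr @^-1: D) (phi \o @serial_inr G H).
Proof.
have inlE e : proper_on phi (@ends (serial G H) (inl e)) =
              proper_on (phi \o inl) (ends e).
  by rewrite /= proper_on_imset // => x y [].
have inrE e : proper_on phi (@ends (serial G H) (inr e)) =
              proper_on (phi \o @serial_inr G H) (ends e).
  by rewrite /= proper_on_imset //; apply: serial_inr_inj.
apply/forall_inP/andP => [h | [/forall_inP h1 /forall_inP h2] [] e eD].
- by split; apply/forall_inP => e; rewrite inE => /h; rewrite ?inlE ?inrE.
- by rewrite inlE h1 // inE.
- by rewrite inrE h2 // inE.
Qed.

Lemma cset_serial D :
  cset D = [set a + b | a in cset (inl @^-1: D), b in cset (inr @^-1: D)].
Proof.
apply/setP => x; apply/csetP/imset2P.
  case=> phi; rewrite coloured_serial => /andP[c1 c2] <-.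
  exists (phi (inl tgt) - phi (inl src))
         (phi (serial_inr G tgt) - phi (serial_inr G src)).
  - by apply/csetP; eexists; first exact: c1.
  - by apply/csetP; eexists; first exact: c2.
  - by rewrite serial_inr_src [RHS]addrC addrA subrK.
case=> _ _ /csetP[f1 c1 <-] /csetP[f2 c2 <-] ->.
(* The second colouring is translated to agree with the first at the glued vertex; its own
   difference is unaffected. *)
pose psi (y : vert (serial G H)) := match y with
  | inl y => f1 y | inr y => f2 (val y) + (f1 tgt - f2 src) end.
have psiE y : psi (serial_inr G y) = f2 y + (f1 tgt - f2 src).
  rewrite /serial_inr; case: insubP => [u _ <- // | /negPn/eqP->] /=.
  by rewrite addrC subrK.
exists psi.
  rewrite coloured_serial c1 /= (eq_coloured _ psiE).
  by rewrite coloured_shift.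
have -> : psi tgt = f2 tgt + (f1 tgt - f2 src) by exact: psiE.
by rewrite addrCA addrAC.
Qed.

End SerialColourings.

Section ParallelColourings.
Variables G H : tgraph.
Implicit Type D : {set edge (parallel G H)}.

Lemma parallel_inr_src : parallel_inr G (@src H) = inl src.
Proof. by rewrite /parallel_inr insubF ?inE ?eqxx. Qed.

Lemma parallel_inr_tgt : parallel_inr G (@tgt H) = inl tgt.
Proof.
by rewrite /parallel_inr insubF ?inE ?eqxx ?orbT ?(negbTE (tgt_neq_src H)).
Qed.

Lemma coloured_parallel D phi :
  coloured D phi = coloured (inl @^-1: D) (phi \o inl)
                   && coloured (inr @^-1: D) (phi \o @parallel_inr G H).
Proof.
have inlE e : proper_on phi (@ends (parallel G H) (inl e)) =
              proper_on (phi \o inl) (ends e).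
  by rewrite /= proper_on_imset // => x y [].
have inrE e : proper_on phi (@ends (parallel G H) (inr e)) =
              proper_on (phi \o @parallel_inr G H) (ends e).
  by rewrite /= proper_on_imset //; apply: parallel_inr_inj.
apply/forall_inP/andP => [h | [/forall_inP h1 /forall_inP h2] [] e eD].
- by split; apply/forall_inP => e; rewrite inE => /h; rewrite ?inlE ?inrE.
- by rewrite inlE h1 // inE.
- by rewrite inrE h2 // inE.
Qed.

Lemma cset_parallel D : cset D = cset (inl @^-1: D) :&: cset (inr @^-1: D).
Proof.
apply/setP => x; rewrite in_setI; apply/csetP/andP.
  case=> phi; rewrite coloured_parallel => /andP[c1 c2] <-.
  split; apply/csetP; eexists; try eassumption; rewrite //=.
  by rewrite parallel_inr_src parallel_inr_tgt.
case=> /csetP[f1 c1 x1] /csetP[f2 c2 x2].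
(* Because the two differences are equal, the translation that aligns the sources also aligns the
   targets. *)
have tE : f1 tgt = f2 tgt + (f1 src - f2 src).
  by rewrite addrCA x2 -x1 addrC subrK.
pose psi (y : vert (parallel G H)) := match y with
  | inl y => f1 y | inr y => f2 (val y) + (f1 src - f2 src) end.
have psiE y : psi (parallel_inr G y) = f2 y + (f1 src - f2 src).
  rewrite /parallel_inr; case: insubP => [u _ <- // |] /=.
  rewrite negbK !inE => /orP[] /eqP->; first by rewrite eqxx addrC subrK.
  by rewrite (negbTE (tgt_neq_src H)).
exists psi => //.
by rewrite coloured_parallel c1 /= (eq_coloured _ psiE) coloured_shift.
Qed.

End ParallelColourings.

(** With the next two lemmas: deleting an edge of a sum deletes it from its own summand and leaves
    the other summand whole. *)
Lemma preimset_C1 (A B : finType) (f : A -> B) (x : A) :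
  injective f -> f @^-1: [set~ f x] = [set~ x].
Proof. by move=> f_inj; apply/setP => y; rewrite !inE inj_eq. Qed.

Lemma preim_inl_C1r (A B : finType) (b : B) :
  (@inl A B) @^-1: [set~ inr b] = setT.
Proof. by apply/setP => y; rewrite !inE. Qed.

Lemma preim_inr_C1l (A B : finType) (a : A) :
  (@inr A B) @^-1: [set~ inl a] = setT.
Proof. by apply/setP => y; rewrite !inE. Qed.

(** * Symmetric subsets of Z_5 as bit triples *)

(** A symmetric subset of Z_5 is determined by which of 0, 1, 2 it contains;
    [badd] is the sumset operation in this encoding. *)
Definition bits (S : {set 'Z_5}) : bool * bool * bool :=
  (0 \in S, 1 \in S, 2 \in S).

Definition symmetric (S : {set 'Z_5}) := forall x, (- x \in S) = (x \in S).

Lemma Z5_cases (x : 'Z_5) : x \in [:: 0; 1; 2; - 1; - 2].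
Proof. by case: x => [[|[|[|[|[|]]]]]]. Qed.

Lemma bits_inj S T : symmetric S -> symmetric T -> bits S = bits T -> S = T.
Proof.
move=> symS symT [b0 b1 b2]; apply/setP => x.
by have := Z5_cases x; rewrite !inE => /or4P[|||/orP[]] /eqP->; rewrite ?symS ?symT.
Qed.

Definition badd (p q : bool * bool * bool) : bool * bool * bool :=
  let: (p0, p1, p2) := p in let: (q0, q1, q2) := q in
  ([|| p0 && q0, p1 && q1 | p2 && q2],
   [|| p0 && q1, p1 && q0, p1 && q2, p2 && q1 | p2 && q2],
   [|| p0 && q2, p2 && q0, p1 && q1, p1 && q2 | p2 && q1]).

Definition band (p q : bool * bool * bool) : bool * bool * bool :=
  (p.1.1 && q.1.1, p.1.2 && q.1.2, p.2 && q.2).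

Definition ble (p q : bool * bool * bool) : bool :=
  [&& p.1.1 ==> q.1.1, p.1.2 ==> q.1.2 & p.2 ==> q.2].

(** Of the eight triples, the six left are exactly the encodings of [six_sets]. *)
Definition nontrivial (p : bool * bool * bool) : bool :=
  p \notin [:: (false, false, false); (true, true, true)].

Lemma bitsI (S T : {set 'Z_5}) : bits (S :&: T) = band (bits S) (bits T).
Proof. by rewrite /bits !inE. Qed.

Lemma bitsS (S T : {set 'Z_5}) : S \subset T -> ble (bits S) (bits T).
Proof. by move=> /subsetP sST; apply/and3P; split; apply/implyP; apply: sST. Qed.

Lemma bitsD S T : symmetric S -> symmetric T ->
  bits [set a + b | a in S, b in T] = badd (bits S) (bits T).
Proof.
move=> symS symT.
(* The second summand is determined as [x - a], so membership becomes a search over the five values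
   of [a]. *)
have E x : (x \in [set a + b | a in S, b in T]) =
    has (fun a => (a \in S) && (x - a \in T)) [:: 0; 1; 2; - 1; - 2].
  apply/imset2P/hasP => [[a b aS bT ->] | [a _ /andP[aS bT]]].
    by exists a; rewrite ?Z5_cases // aS addrC addKr.
  by exists a (x - a); rewrite // addrC subrK.
(* These identities bring every [x - a] to one of 0, 1, 2, -1, -2; symmetry then leaves only the
   three bits. *)
have d1 : 1 - 2 = - 1 :> 'Z_5 by apply: val_inj.
have d2 : 2 - 1 = 1 :> 'Z_5 by apply: val_inj.
have d3 : 1 + 1 = 2 :> 'Z_5 by apply: val_inj.
have d4 : 1 + 2 = - 2 :> 'Z_5 by apply: val_inj.
have d5 : 2 + 2 = - 1 :> 'Z_5 by apply: val_inj.
have d6 : 2 + 1 = - 2 :> 'Z_5 by apply: val_inj.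
rewrite /bits !E /= !opprK !sub0r !subr0 oppr0 !subrr ?add0r ?opprK.
rewrite ?(d1, d2, d3, d4, d5, d6) !symS !symT.
by case: (0 \in S); case: (1 \in S); case: (2 \in S);
   case: (0 \in T); case: (1 \in T); case: (2 \in T).
Qed.

Lemma sset_symmetric i : symmetric (sset i).
Proof. by move=> x; rewrite !inE eqr_oppLR eqr_opp orbC. Qed.

Lemma sbar_symmetric i : symmetric (sbar i).
Proof. by move=> x; rewrite !in_setC sset_symmetric. Qed.

Lemma bits_six :
  (bits (sset 0) = (true, false, false)) *
  (bits (sset 1) = (false, true, false)) *
  (bits (sset 2) = (false, false, true)) *
  (bits (sbar 0) = (false, true, true)) *
  (bits (sbar 1) = (true, false, true)) *
  (bits (sbar 2) = (true, true, false)).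
Proof. by rewrite /bits !inE. Qed.

Lemma six_symmetric S : S \in six_sets -> symmetric S.
Proof.
rewrite !inE => /or4P[|||/or3P[]] /eqP->;
  by [apply: sset_symmetric | apply: sbar_symmetric].
Qed.

Lemma six_nontrivial S : S \in six_sets -> nontrivial (bits S).
Proof. by rewrite !inE => /or4P[|||/or3P[]] /eqP->; rewrite bits_six. Qed.

Lemma six_bits_inj S T :
  S \in six_sets -> T \in six_sets -> bits S = bits T -> S = T.
Proof. by move=> /six_symmetric symS /six_symmetric symT; apply: bits_inj. Qed.

(** * Profiles and edge-criticality *)

Section Profile.
Variable G : tgraph.

Definition prof (D : {set edge G}) : bool * bool * bool := bits (cset D).

(** Deletion can only enlarge a difference set, so a changed profile is a strictly larger one. *)
Definition critical : Prop := forall e, prof [set~ e] <> prof setT.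

Lemma prof_del e : ble (prof setT) (prof [set~ e]).
Proof. by apply/bitsS/csetS/subsetT. Qed.

End Profile.

Section SumProfiles.
Variables G H : tgraph.

Lemma prof_serialT :
  prof [set: edge (serial G H)] = badd (@prof G setT) (@prof H setT).
Proof.
rewrite /prof cset_serial !preimsetT bitsD //; by move=> x; apply: csetN.
Qed.

Lemma prof_serial_inl e :
  @prof (serial G H) [set~ inl e] = badd (@prof G [set~ e]) (@prof H setT).
Proof.
rewrite /prof cset_serial preim_inr_C1l preimset_C1; last by move=> x y [].
by rewrite bitsD // => x; apply: csetN.
Qed.

Lemma prof_serial_inr e :
  @prof (serial G H) [set~ inr e] = badd (@prof G setT) (@prof H [set~ e]).
Proof.
rewrite /prof cset_serial preim_inl_C1r preimset_C1; last by move=> x y [].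
by rewrite bitsD // => x; apply: csetN.
Qed.

Lemma prof_parallelT :
  prof [set: edge (parallel G H)] = band (@prof G setT) (@prof H setT).
Proof. by rewrite /prof cset_parallel !preimsetT bitsI. Qed.

Lemma prof_parallel_inl e :
  @prof (parallel G H) [set~ inl e] = band (@prof G [set~ e]) (@prof H setT).
Proof.
rewrite /prof cset_parallel preim_inr_C1l preimset_C1; last by move=> x y [].
by rewrite bitsI.
Qed.

Lemma prof_parallel_inr e :
  @prof (parallel G H) [set~ inr e] = band (@prof G setT) (@prof H [set~ e]).
Proof.
rewrite /prof cset_parallel preim_inl_C1r preimset_C1; last by move=> x y [].
by rewrite bitsI.
Qed.

(** The two conditions range over all larger triples, not only those realised by deletions, so that
    each application is a finite check. *)
Lemma critical_serial :
  critical G -> critical H ->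
  (forall p, ble (@prof G setT) p -> p != @prof G setT ->
     badd p (@prof H setT) <> badd (@prof G setT) (@prof H setT)) ->
  (forall p, ble (@prof H setT) p -> p != @prof H setT ->
     badd (@prof G setT) p <> badd (@prof G setT) (@prof H setT)) ->
  critical (serial G H).
Proof.
move=> cG cH hG hH [] e; rewrite prof_serialT ?prof_serial_inl ?prof_serial_inr.
  by apply: hG; [apply: prof_del | apply/eqP/cG].
by apply: hH; [apply: prof_del | apply/eqP/cH].
Qed.

Lemma critical_parallel :
  critical G -> critical H ->
  (forall p, ble (@prof G setT) p -> p != @prof G setT ->
     band p (@prof H setT) <> band (@prof G setT) (@prof H setT)) ->
  (forall p, ble (@prof H setT) p -> p != @prof H setT ->
     band (@prof G setT) p <> band (@prof G setT) (@prof H setT)) ->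
  critical (parallel G H).
Proof.
move=> cG cH hG hH [] e;
  rewrite prof_parallelT ?prof_parallel_inl ?prof_parallel_inr.
  by apply: hG; [apply: prof_del | apply/eqP/cG].
by apply: hH; [apply: prof_del | apply/eqP/cH].
Qed.

(** The profile of a sum depends only on the profiles of its summands, so an edge irrelevant to a
    summand is irrelevant to the sum. *)
Lemma critical_serial_inv : critical (serial G H) -> critical G /\ critical H.
Proof.
move=> c; split=> e eE; [apply: (c (inl e)) | apply: (c (inr e))];
  by rewrite ?prof_serial_inl ?prof_serial_inr eE prof_serialT.
Qed.

Lemma critical_parallel_inv :
  critical (parallel G H) -> critical G /\ critical H.
Proof.
move=> c; split=> e eE; [apply: (c (inl e)) | apply: (c (inr e))];
  by rewrite ?prof_parallel_inl ?prof_parallel_inr eE prof_parallelT.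
Qed.

End SumProfiles.

Lemma prof_same G H : same_tgraph G H ->
  exists2 fe : edge G -> edge H, bijective fe &
    forall D, prof D = prof (fe @^-1: D).
Proof.
case=> -[fv [fe [emb _ fe_bij]]]; exists fe => // D; rewrite /prof.
  by rewrite (cset_iso _ emb).
by rewrite -cset_reverse (cset_iso _ emb).
Qed.

Lemma prof_sameT G H : same_tgraph G H -> @prof G setT = @prof H setT.
Proof. by case/prof_same=> fe _ ->; rewrite preimsetT. Qed.

Lemma prof_same_del G H : same_tgraph G H ->
  exists2 fe : edge G -> edge H, bijective fe &
    forall e, prof [set~ fe e] = prof [set~ e].
Proof.
move=> /prof_same[fe fe_bij h]; exists fe => // e.
by rewrite h preimset_C1 //; apply: bij_inj.
Qed.

Lemma critical_same G H : same_tgraph G H -> critical H <-> critical G.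
Proof.
move=> sGH; have [fe [fe' _ feK] h] := prof_same_del sGH.
split=> c e eE; first by apply: (c (fe e)); rewrite h eE (prof_sameT sGH).
by apply: (c (fe' e)); rewrite -h feK eE (prof_sameT sGH).
Qed.

(** * The single edge, and structure of series-parallel graphs *)

Lemma cset_K2 D x : (x \in @cset K2 D) = (tt \in D) ==> (x \in sset 1).
Proof.
apply/csetP/implyP => [[phi c <-] ttD | h].
  by have /forall_inP/(_ tt ttD)/proper_onP := c; apply; rewrite ?inE.
exists (fun b => if b then x else 0); last by rewrite /= subr0.
apply/forall_inP => -[ttD]; apply/proper_onP => -[] [] //= _ _ _.
  by rewrite subr0 h.
by rewrite sub0r sset1N h.
Qed.

Lemma prof_K2T : @prof K2 setT = (false, true, false).
Proof. by rewrite /prof /bits !cset_K2 !inE. Qed.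

Lemma prof_K2_del e : @prof K2 [set~ e] = (true, true, true).
Proof. by case: e; rewrite /prof /bits !cset_K2 !inE eqxx. Qed.

Lemma critical_K2 : critical K2.
Proof. by move=> e; rewrite prof_K2_del prof_K2T. Qed.

Lemma sp_edge G : series_parallel G -> inhabited (edge G).
Proof.
elim=> {G} [|G H _ [e] _ _|G H _ [e] _ _|G H sGH _ [e]]; first by split; exact: tt.
- by split; exact: (inl e).
- by split; exact: (inl e).
- by have [fe] := prof_same sGH; split; exact: (fe e).
Qed.

(** Ensures that an embedding onto all edges is also onto all vertices. *)
Lemma sp_no_isolated G : series_parallel G -> forall v, exists e, v \in @ends G e.
Proof.
elim=> {G} [v|G H _ IG _ IH v|G H _ IG _ IH v|G H sGH _ IG v].
- by exists tt; rewrite inE.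
- case: v => [v | y]; first by have [e ve] := IG v; exists (inl e); apply: imset_f.
  have [e ye] := IH (val y); exists (inr e).
  by rewrite -serial_inr_val; apply: imset_f.
- case: v => [v | y]; first by have [e ve] := IG v; exists (inl e); apply: imset_f.
  have [e ye] := IH (val y); exists (inr e); apply/imsetP; exists (val y) => //.
  by rewrite /parallel_inr valK.
- case: sGH => -[fv [fe [[_ _ efe _ _] [fv' _ fvK] _]]];
    have [e ve] := IG (fv' v); exists (fe e);
    have /= -> := efe e; rewrite -(fvK v); exact: imset_f.
Qed.

(** * Minimality as edge-criticality *)

Section DeleteEdge.
Variables (G : tgraph) (e : edge G).

Definition del_edge : tgraph :=
  @TGraph (vert G) {x : edge G | x != e} (fun x => ends (val x)) src tgt
    (fun x => card_ends (val x)) (src_neq_tgt G).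

Lemma del_edge_embedding : @is_embedding del_edge G id val.
Proof. by split=> // [|x]; [apply: val_inj | rewrite imset_id]. Qed.

Lemma del_edge_proper : proper_subgraph del_edge G.
Proof.
exists id, val; split; first exact: del_edge_embedding.
by case=> _ [g _ /(_ e) eE]; have := valP (g e); rewrite eE eqxx.
Qed.

Lemma cset_del_edge : @cset del_edge setT = cset [set~ e].
Proof.
rewrite (cset_embedding del_edge_embedding); last first.
  apply/subsetP => x; rewrite !inE => xe.
  by apply/imsetP; exists (Sub x xe); rewrite ?SubK.
by congr cset; apply/setP => x; rewrite !inE (valP x).
Qed.

End DeleteEdge.

(** Single-edge deletions are proper subgraphs; conversely, without isolated vertices every proper
    subgraph misses an edge. *)
Lemma minimally_forcingE S G : series_parallel G ->
  minimally_forcing S G <-> [/\ S != set0, @cset G setT = S & critical G].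
Proof.
move=> spG; split=> [[/forcingE[Sn0 SE] minG] | [Sn0 SE critG]].
  split=> // e eE; apply: (minG _ (del_edge_proper e)); apply/forcingE.
  split=> //; rewrite cset_del_edge -SE.
  by apply: bits_inj eE => x; rewrite csetN.
split; first by apply/forcingE.
move=> H [fv [fe [emb not_bij]]] /forcingE[_ HE].
(* If every edge is hit, then so is every vertex, and the embedding is not proper. *)
have [fe_onto | ] := boolP ([set: edge G] \subset fe @: setT).
  case: emb => fv_inj fe_inj efe _ _; apply: not_bij.
  have onto e : exists e', fe e' == e.
    by have /imsetP[e' _ ->] := subsetP fe_onto e (in_setT e); exists e'.
  have ontov v : exists v', fv v' == v.
    have [e ve] := sp_no_isolated spG v; have [e' /eqP e'E] := onto e.
    by move: ve; rewrite -e'E efe => /imsetP[v' _ ->]; exists v'.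
  split; [exists (fun v => xchoose (ontov v)) | exists (fun e => xchoose (onto e))].
  - by move=> x; apply: fv_inj; apply/eqP/(xchooseP (ontov (fv x))).
  - by move=> x; apply/eqP/(xchooseP (ontov x)).
  - by move=> x; apply: fe_inj; apply/eqP/(xchooseP (onto (fe x))).
  - by move=> x; apply/eqP/(xchooseP (onto x)).
case/subsetPn=> e _ eNfe; apply: (critG e); rewrite /prof; congr bits.
(* For a missed edge [e], the set after deleting [e] lies between [cset] of [G] and [cset] of [H],
   both equal to [S]. *)
apply/eqP; rewrite eqEsubset [X in _ && X]csetS ?subsetT // andbT SE -HE.
have -> : @cset H setT = cset (fe @: setT).
  rewrite (cset_embedding emb) //; congr cset.
  by apply/setP => x; rewrite !inE imset_f.
by apply/csetS/subsetP => x xfe; rewrite !inE; apply: contraNneq eNfe => <-.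
Qed.

(** * Reversal of serial sums *)

Lemma same_reverse G : same_tgraph G (reverse G).
Proof.
right; exists id, id; split; try by exists id.
by split=> // e; rewrite imset_id.
Qed.

Section SerialSwap.
Variables G H : tgraph.

(** In the reversed sum the glued vertex is represented by the source of [H], hence [serial_inr] on
    the vertices of [G]. *)
Definition serial_swap (x : serial_vert G H) :
    serial_vert (reverse H) (reverse G) :=
  match x with
  | inl x => @serial_inr (reverse H) (reverse G) x
  | inr y => inl (val y)
  end.

Lemma serial_swap_inr y : serial_swap (serial_inr G y) = inl y.
Proof.
rewrite /serial_inr; case: insubP => [u _ <- // | /negPn/eqP->] /=.
by rewrite (@serial_inr_src (reverse H) (reverse G)).
Qed.

End SerialSwap.

(** Double reversal restores vertices and terminals by computation, so the two swaps compose without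
    transport. *)
Lemma serial_swapK G H :
  cancel (@serial_swap G H) (@serial_swap (reverse H) (reverse G)).
Proof.
case=> [x | y] /=; first exact: (@serial_swap_inr (reverse H) (reverse G)).
exact: serial_inr_val.
Qed.

Lemma same_serial_reverse G H :
  same_tgraph (serial (reverse H) (reverse G)) (serial G H).
Proof.
pose sw (T U : Type) (e : T + U) :=
  match e with inl a => inr a | inr b => inl b end.
have swK T U : cancel (sw T U) (sw U T) by case.
right; exists (@serial_swap (reverse H) (reverse G)), (sw _ _); split.
- split.
  + exact: can_inj (@serial_swapK (reverse H) (reverse G)).
  + exact: can_inj (swK _ _).
  + case=> e /=; rewrite -imset_comp; apply: eq_imset => x //=.
    exact/esym/(@serial_swap_inr (reverse H) (reverse G)).
  + by [].
  + exact: (@serial_swap_inr (reverse H) (reverse G)).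
- exists (@serial_swap G H); last exact: serial_swapK.
  exact: (@serial_swapK (reverse H) (reverse G)).
- by exists (sw _ _).
Qed.

Lemma calT_reverse S G : calT S G -> calT S (reverse G).
Proof. exact/calT_same/same_reverse. Qed.

(** Makes the asymmetric rules (iii) and (iv) available with the summands in the other order. *)
Lemma calT_serial_swap S G H :
  calT S (serial (reverse H) (reverse G)) -> calT S (serial G H).
Proof. exact/calT_same/same_serial_reverse. Qed.

(** * The generating rules preserve the invariant *)

(** The last conjunct excludes a minimal serial sum of an s(1)- and an
    s(2)-forcing graph: (true, false, true) encodes {0, 2, -2}. *)
Definition T_invariant S G : Prop :=
  [/\ S \in six_sets, series_parallel G, @prof G setT = bits S, critical G &
      S = sset 2 -> exists e, @prof G [set~ e] = (true, false, true)].

(** Each summand set misses a single class {k, -k}, so any strict enlargement is all of Z_5 and the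
    intersection grows to the other set. *)
Lemma T_invariant_parallel (i j l : 'Z_5) G H :
  i \in [set 0; 1; 2] -> j \in [set 0; 1; 2] -> i != j ->
  [set l] = [set 0; 1; 2] :\: [set i; j] ->
  T_invariant (sbar i) G -> T_invariant (sbar j) H ->
  T_invariant (sset l) (parallel G H).
Proof.
move=> i3 j3 ij lE [_ spG pG cG _] [_ spH pH cH _].
have lP k : k \in [set 0; 1; 2] :\: [set i; j] -> l = k.
  by rewrite -lE inE => /eqP.
have [eG] := sp_edge spG; have [eH] := sp_edge spH.
have fullG : @prof G [set~ eG] = (true, true, true).
  have := prof_del eG; have := cG eG; rewrite pG.
  move: i3; rewrite !inE => /orP[/orP[]|] /eqP->; rewrite !bits_six;
  by case: prof => [[[] []] []].
have fullH : @prof H [set~ eH] = (true, true, true).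
  have := prof_del eH; have := cH eH; rewrite pH.
  move: j3; rewrite !inE => /orP[/orP[]|] /eqP->; rewrite !bits_six;
  by case: prof => [[[] []] []].
have spGH := sp_parallel spG spH.
move: i3 j3 ij lP pG pH; rewrite !inE.
move=> /orP[/orP[]|] /eqP-> /orP[/orP[]|] /eqP-> // _ lP; rewrite !bits_six => pG pH;
  [ have {lP lE}-> : l = 2 by apply: lP; rewrite !inE
  | have {lP lE}-> : l = 1 by apply: lP; rewrite !inE
  | have {lP lE}-> : l = 2 by apply: lP; rewrite !inE
  | have {lP lE}-> : l = 0 by apply: lP; rewrite !inE
  | have {lP lE}-> : l = 1 by apply: lP; rewrite !inE
  | have {lP lE}-> : l = 0 by apply: lP; rewrite !inE ];
  (split; [ by rewrite !inE eqxx ?orbT | by []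
   | by rewrite prof_parallelT pG pH !bits_six
   | by apply: critical_parallel => //; rewrite pG pH => -[[[] []] []]
   | move=> /(congr1 bits); rewrite !bits_six => // _ ]).
  (* For l = 2 the pair is 0, 1: deleting an edge of the sbar(0) summand leaves sbar(1) = {0, 2,
     -2}. *)
  by exists (inl eG); rewrite prof_parallel_inl fullG pH.
by exists (inr eH); rewrite prof_parallel_inr fullH pG.
Qed.

(** Here s(i) + s(i) = {0, 2i, -2i}, and 2i, -2i are the nonzero residues other than i, -i. *)
Lemma T_invariant_serial_bar (i : 'Z_5) G H : i \in [set 1; 2] ->
  T_invariant (sset i) G -> T_invariant (sset i) H ->
  T_invariant (sbar i) (serial G H).
Proof.
move=> i2 [_ spG pG cG _] [_ spH pH cH _]; have spGH := sp_serial spG spH.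
by move: i2 pG pH; rewrite !inE => /orP[] /eqP->; rewrite !bits_six => pG pH;
  (split; [ by rewrite !inE eqxx ?orbT | by []
   | by rewrite prof_serialT pG pH !bits_six
   | by apply: critical_serial => //; rewrite pG pH => -[[[] []] []]
   | by move=> /(congr1 bits); rewrite !bits_six ]).
Qed.

(** The sum misses 0 because s(i) and sbar(i) are disjoint and symmetric. *)
Lemma T_invariant_serial_bar0 (i : 'Z_5) G H : i \in [set 1; 2] ->
  T_invariant (sset i) G -> T_invariant (sbar i) H ->
  T_invariant (sbar 0) (serial G H).
Proof.
move=> i2 [_ spG pG cG _] [_ spH pH cH _]; have spGH := sp_serial spG spH.
by move: i2 pG pH; rewrite !inE => /orP[] /eqP->; rewrite !bits_six => pG pH;
  (split; [ by rewrite !inE eqxx ?orbT | by []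
   | by rewrite prof_serialT pG pH !bits_six
   | by apply: critical_serial => //; rewrite pG pH => -[[[] []] []]
   | by move=> /(congr1 bits); rewrite !bits_six ]).
Qed.

(** {0} is neutral for sumsets. Enlarging it by k, -k enlarges the sum, since a proper nonempty
    subset of Z_5 is not invariant under a nonzero translation. *)
Lemma T_invariant_serial0 S G H :
  T_invariant S G -> T_invariant (sset 0) H -> T_invariant S (serial G H).
Proof.
move=> [S6 spG pG cG wG] [_ spH pH cH _]; rewrite bits_six in pH.
split=> //; first exact: sp_serial.
- by rewrite prof_serialT pH pG; case: bits => [[[] []] []].
- have nG := six_nontrivial S6; rewrite -pG in nG.
  apply: critical_serial => //; rewrite pH => p;
    by move: (@prof G setT) nG p => [[[] []] []] // _ [[[] []] []].
- move=> /wG[e eE]; exists (inl e).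
  by rewrite prof_serial_inl eE pH.
Qed.

Lemma T_invariant_same S G H :
  same_tgraph G H -> T_invariant S G -> T_invariant S H.
Proof.
move=> sGH [S6 spG pG cG wG]; split=> //; first exact: sp_same sGH spG.
- by rewrite -(prof_sameT sGH).
- exact/(critical_same sGH).
- by have [fe _ h] := prof_same_del sGH; move=> /wG[e eE]; exists (fe e); rewrite h.
Qed.

Lemma T_invariant_K2 : T_invariant (sset 1) K2.
Proof.
split; rewrite ?bits_six ?prof_K2T //; first by rewrite !inE eqxx ?orbT.
- exact: sp_K2.
- exact: critical_K2.
- by move=> /(congr1 bits); rewrite !bits_six.
Qed.

Lemma calT_invariant S G : calT S G -> T_invariant S G.
Proof.
elim=> {S G} [|i j l G H i3 j3 ij lE _ IG _ IH|i G H i2 _ IG _ IH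
  |i G H i2 _ IG _ IH|S G H _ _ IG _ IH|S G H sGH _ IG].
- exact: T_invariant_K2.
- exact: T_invariant_parallel IG IH.
- exact: T_invariant_serial_bar.
- exact: T_invariant_serial_bar0 IG IH.
- exact: T_invariant_serial0.
- exact: T_invariant_same IG.
Qed.

(** * Critical series-parallel graphs are generated *)

(** An exhaustive check of 64 pairs. The last two listed pairs match no rule and are refuted later
    by criticality. *)
Lemma badd_nontrivial p q : nontrivial (badd p q) ->
  [|| p == bits (sset 0), q == bits (sset 0) |
   has (fun A => (p == bits A.1) && (q == bits A.2))
     [:: (sset 1, sset 1); (sset 2, sset 2); (sset 1, sbar 1); (sset 2, sbar 2);
         (sbar 1, sset 1); (sbar 2, sset 2); (sset 1, sset 2); (sset 2, sset 1)]].
Proof.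
by rewrite /= !bits_six; case: p => [[[] []] []]; case: q => [[[] []] []].
Qed.

(** Incomparable unions of the classes {0}, {1, -1}, {2, -2} that still meet consist of two classes
    each. *)
Lemma band_nontrivial p q : nontrivial (band p q) ->
  [|| band p q == p, band p q == q |
   has (fun A => (p == bits A.1) && (q == bits A.2))
     [:: (sbar 0, sbar 1); (sbar 0, sbar 2); (sbar 1, sbar 2);
         (sbar 1, sbar 0); (sbar 2, sbar 0); (sbar 2, sbar 1)]].
Proof.
by rewrite /= !bits_six; case: p => [[[] []] []]; case: q => [[[] []] []].
Qed.

Lemma band_ble p q r : ble q r -> band p q = p -> band p r = p.
Proof.
by case: p => [[[] []] []]; case: q => [[[] []] []]; case: r => [[[] []] []].
Qed.

Lemma bandC p q : band p q = band q p.
Proof. by rewrite /band; congr (_, _, _); apply: andbC. Qed.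

Lemma set1_setD2 (i j l : 'Z_5) : uniq [:: i; j; l] ->
  i \in [set 0; 1; 2] -> j \in [set 0; 1; 2] -> l \in [set 0; 1; 2] ->
  [set l] = [set 0; 1; 2] :\: [set i; j].
Proof.
rewrite !inE => u i3 j3 l3; apply/setP => x; rewrite !inE.
by move: i3 j3 l3 u => /orP[/orP[]|] /eqP-> /orP[/orP[]|] /eqP-> /orP[/orP[]|]
  /eqP-> //= _; have := Z5_cases x; rewrite !inE => /or4P[|||/orP[]] /eqP->.
Qed.

(** If one set contained the other, deleting an edge from the summand with the larger set would not
    change the intersection. *)
Lemma critical_parallel_incomparable G H :
  series_parallel G -> series_parallel H -> critical (parallel G H) ->
  band (@prof G setT) (@prof H setT) != @prof G setT /\
  band (@prof G setT) (@prof H setT) != @prof H setT.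
Proof.
move=> spG spH c; have [eG] := sp_edge spG; have [eH] := sp_edge spH.
split; apply/eqP => pq; [apply: (c (inr eH)) | apply: (c (inl eG))].
  by rewrite prof_parallel_inr prof_parallelT pq (band_ble (prof_del eH)).
rewrite prof_parallel_inl prof_parallelT pq bandC.
by rewrite (band_ble (prof_del eG)) // bandC.
Qed.

Lemma sset_six (i : 'Z_5) : i \in [set 0; 1; 2] -> sset i \in six_sets.
Proof. by rewrite !inE => /orP[/orP[]|] /eqP->; rewrite !eqxx ?orbT. Qed.

Lemma sbar_six (i : 'Z_5) : i \in [set 0; 1; 2] -> sbar i \in six_sets.
Proof. by rewrite !inE => /orP[/orP[]|] /eqP->; rewrite !eqxx ?orbT. Qed.

(** [S] is quantified inside the induction because the summands may force other sets among the
    six. *)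
Lemma calT_of_critical G : series_parallel G -> critical G ->
  forall S, S \in six_sets -> bits S = @prof G setT -> calT S G.
Proof.
have toS S T K : S \in six_sets -> T \in six_sets -> bits S = bits T ->
    calT T K -> calT S K.
  by move=> S6 T6 /(six_bits_inj S6 T6) ->.
have [z3 o3 t3] : [/\ (0 : 'Z_5) \in [set 0; 1; 2],
    (1 : 'Z_5) \in [set 0; 1; 2] & (2 : 'Z_5) \in [set 0; 1; 2]].
  by rewrite !inE.
have [s0 s1 s2] := And3 (sset_six z3) (sset_six o3) (sset_six t3).
have [b0 b1 b2] := And3 (sbar_six z3) (sbar_six o3) (sbar_six t3).
elim=> {G} [|G H spG IG spH IH|G H spG IG spH IH|G H sGH spG IG] c S S6.
- by rewrite prof_K2T => SE; apply: toS calT_K2; rewrite // SE bits_six.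
- have [cG cH] := critical_serial_inv c.
  rewrite prof_serialT => SE; have := six_nontrivial S6.
  move: IG IH => /(_ cG) IG /(_ cH) IH.
  rewrite SE => /badd_nontrivial/or3P[/eqP pE | /eqP qE | ].
  (* Rule (iv) wants the s(0) summand second, so the reversed sum is used. *)
  + apply/calT_serial_swap/calT_serial0 => //; apply: calT_reverse.
      apply: IH => //; rewrite SE pE bits_six.
      by case: (@prof H setT) => [[[] []] []].
    by apply: IG.
  + apply: calT_serial0 => //; last by apply: IH.
    apply: IG => //; rewrite SE qE bits_six.
    by case: (@prof G setT) => [[[] []] []].
  rewrite /= orbF.
  move=> /or4P[|||/or4P[|||/orP[]]] /andP[/eqP pE /eqP qE].
  + apply: (toS _ (sbar 1)) => //; first by rewrite SE pE qE !bits_six.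
    by apply: (@calT_serial_bar 1); [rewrite !inE | apply: IG | apply: IH].
  + apply: (toS _ (sbar 2)) => //; first by rewrite SE pE qE !bits_six.
    by apply: (@calT_serial_bar 2); [rewrite !inE | apply: IG | apply: IH].
  + apply: (toS _ (sbar 0)) => //; first by rewrite SE pE qE !bits_six.
    by apply: (@calT_serial_bar0 1); [rewrite !inE | apply: IG | apply: IH].
  + apply: (toS _ (sbar 0)) => //; first by rewrite SE pE qE !bits_six.
    by apply: (@calT_serial_bar0 2); [rewrite !inE | apply: IG | apply: IH].
  + apply: (toS _ (sbar 0)) => //; first by rewrite SE pE qE !bits_six.
    apply: calT_serial_swap.
    by apply: (@calT_serial_bar0 1);
      [rewrite !inE | apply/calT_reverse/IH | apply/calT_reverse/IG].
  + apply: (toS _ (sbar 0)) => //; first by rewrite SE pE qE !bits_six.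
    apply: calT_serial_swap.
    by apply: (@calT_serial_bar0 2);
      [rewrite !inE | apply/calT_reverse/IH | apply/calT_reverse/IG].
  (* The s(1), s(2) case: deleting [e] turns s(2) into {0, 2, -2}, and s(1) + {0, 2, -2} is again
     sbar(0), against criticality. *)
  + have /calT_invariant[_ _ _ _ /(_ erefl)[e eE]] : calT (sset 2) H by apply: IH.
    by case: (c (inr e)); rewrite prof_serial_inr prof_serialT eE pE qE !bits_six.
  + have /calT_invariant[_ _ _ _ /(_ erefl)[e eE]] : calT (sset 2) G by apply: IG.
    by case: (c (inl e)); rewrite prof_serial_inl prof_serialT eE pE qE !bits_six.
- have [cG cH] := critical_parallel_inv c.
  rewrite prof_parallelT => SE; have := six_nontrivial S6.
  (* Criticality removes the two comparable cases, leaving pairs sbar(i), sbar(j) with i and j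
     distinct. *)
  have [/negbTE np /negbTE nq] := critical_parallel_incomparable spG spH c.
  rewrite SE => /band_nontrivial; rewrite np nq /= orbF.
  move: IG IH => /(_ cG) IG /(_ cH) IH.
  have par (i j l : 'Z_5) : uniq [:: i; j; l] ->
      i \in [set 0; 1; 2] -> j \in [set 0; 1; 2] -> l \in [set 0; 1; 2] ->
      @prof G setT = bits (sbar i) -> @prof H setT = bits (sbar j) ->
      bits S = bits (sset l) -> calT S (parallel G H).
    move=> u i3 j3 l3 pE qE SlE.
    have i6 := sbar_six i3; have j6 := sbar_six j3; have l6 := sset_six l3.
    apply: (toS _ (sset l)) => //.
    apply: (calT_parallel i3 j3 _ (set1_setD2 u i3 j3 l3));
      [|exact: IG|exact: IH].
    by move: u => /=; rewrite inE negb_or => /andP[/andP[]].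
  move=> /or4P[|||/or3P[]] /andP[/eqP pE /eqP qE];
    [ apply: (par 0 1 2) | apply: (par 0 2 1) | apply: (par 1 2 0)
    | apply: (par 1 0 2) | apply: (par 2 0 1) | apply: (par 2 1 0) ];
    by rewrite ?inE // SE pE qE !bits_six.
- move=> SE; apply: (calT_same sGH); apply: IG => //.
    exact/(critical_same sGH).
  by rewrite (prof_sameT sGH).
Qed.

Theorem theorem3p2 (S : {set 'Z_5}) (hS : S \in six_sets) (G : tgraph) :
  calT S G <-> calF S G.
Proof.
have symS := six_symmetric hS.
split=> [/calT_invariant[_ spG pG cG _] | [spG /(minimally_forcingE _ spG)[_ SE cG]]].
  split=> //; apply/(minimally_forcingE _ spG); split=> //.
    by apply: contraTneq (six_nontrivial hS) => ->; rewrite /bits !inE.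
  by apply: bits_inj pG => // x; rewrite csetN.
by apply: calT_of_critical => //; rewrite /prof SE.
Qed.
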